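(* Let $G$ be a finite group, let $\sigma$ be an automorphism of $G$ of order two, and let $S\subseteq G$ be a symmetric subset. Suppose that the twisted Cayley sum graph $C_\Sigma(G,S)^\sigma$ is undirected and connected. Then the cop number of $C_\Sigma(G,S)^\sigma$ is at most $2|S|$.
   Context: A subset $S$ of a group $G$ is symmetric if $S=S^{-1}$, where $S^{-1}=\{s^{-1}: s\in S\}$. For an automorphism $\sigma$ of $G$, the twisted Cayley sum graph $C_\Sigma(G,S)^\sigma$ has $G$ as its set of vertices, and there is an edge from $x$ to $y$ if $y=\sigma(x^{-1}s)$ for some $s\in S$ (loops may occur). Such a graph is undirected if its edge relation is symmetric, i.e. whenever there is an edge from $x$ to $y$ there is also an edge from $y$ to $x$. The game of cops and robbers on a finite connected graph is played as follows, with all positions visible to both sides. First, each of the cops chooses a vertex (several cops may occupy the same vertex); then the robber chooses a vertex. The cops and the robber then alternate turns, the cops going first; on a turn, players move along edges of the graph. In the cops' turn each cop may move along an edge or stay in place. It is assumed that the robber moves along some edge in each of its turns (a loop counts as an edge); the robber may not stay idle. The robber is captured when a cop and the robber occupy the same vertex. The cop number of the graph is the minimum number of cops required to capture the robber (after finitely many turns) no matter how the robber plays. *)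

(* Defs.v *)
From mathcomp Require Import all_boot all_order all_fingroup.
From mathcomp Require Import boolp.

Set Implicit Arguments.
Unset Strict Implicit.
Unset Printing Implicit Defensive.

Definition twisted_cayley_sum (gT : finGroupType) (sigma : gT -> gT)
    (S : {set gT}) : rel gT :=
  fun x y => [exists s in S, y == sigma (x^-1 * s)%g].

Definition connected_graph (T : finType) (e : rel T) : Prop :=
  forall x y, connect e x y.

Section CopsAndRobbers.

Variables (T : finType) (e : rel T) (k : nat).

Implicit Types (c : {ffun 'I_k -> T}) (r : T).

Definition captured c r : bool := [exists i, c i == r].

Definition cops_turn c c' : bool :=
  [forall i, (c' i == c i) || e (c i) (c' i)].

(* [cops_win c r]: with the cops at [c], the robber at [r] and the cops to
   move, the cops can force a capture after finitely many turns.  An element of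
   this inductive type is a well-founded strategy tree for the cops.  A robber
   without any legal move is not thereby captured, hence the hypothesis
   [exists r', e r r']; in a connected graph with at least two vertices it
   always holds. *)
Inductive cops_win c r : Prop :=
| WinCaptured of captured c r
| WinCapturing c' of cops_turn c c' & captured c' r
| WinTurn c' of cops_turn c c' & (exists r', e r r')
    & (forall r', e r r' -> cops_win c' r').

Definition cops_suffice : Prop := exists c, forall r, cops_win c r.

End CopsAndRobbers.

Lemma card_cops_suffice (T : finType) (e : rel T) :
  exists k, `[< cops_suffice e k >].
Proof.
exists #|T|; apply/asboolP; exists [ffun i => enum_val i] => r.
by apply: WinCaptured; apply/existsP; exists (enum_rank r);
  rewrite ffunE enum_rankK.
Qed.

Definition cop_number (T : finType) (e : rel T) : nat :=
  ex_minn (card_cops_suffice e).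

(* Main.v *)
(** Undirectedness forces S to be stable under sigma and under conjugation.
    With tau x := sigma(x)^-1, an involutive automorphism of the graph, x and
    tau y are adjacent exactly when x^-1 y is in S; so, up to applying tau at
    every other turn, moving players play on the Cayley graph of G.  In that
    game the cop in charge of a in S copies the robber's moves other than a,
    which keeps d := c^-1 r fixed, and answers a by a move u of its choice,
    which turns d into d u^-1 a.  Since 1 is in a^-1 S, some power of a^-1 S is
    the subgroup H := <<S^-1 S>>, so if d is in H the cop can bring it to 1
    after boundedly many robber moves a.  By connectedness H has index at most
    2, and cops in the wrong coset of H correct this by idling once.  Hence
    already |S| cops, all starting at 1, suffice. *)
Require Import Defs.
From mathcomp Require Import all_boot all_order all_fingroup.
From mathcomp Require Import boolp.

Set Implicit Arguments.
Unset Strict Implicit.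
Unset Printing Implicit Defensive.

Local Open Scope group_scope.

Lemma cop_number_le (T : finType) (e : rel T) k :
  cops_suffice e k -> cop_number e <= k.
Proof.
by move=> ek; rewrite /cop_number; case: ex_minnP => m _; apply; apply/asboolP.
Qed.

Section DifferenceGroup.

Variables (gT : finGroupType) (S : {set gT}).

Definition diffg : {group gT} := <<S^-1 * S>>%G.

Lemma mem_diffg x y : x \in S -> y \in S -> x^-1 * y \in diffg.
Proof. by move=> xS yS; rewrite mem_gen // mem_mulg // inE invgK. Qed.

Lemma diffg_expgs a : a \in S -> exists n, diffg \subset (a^-1 *: S) ^+ n.
Proof.
move=> aS; have [n Xn] := gen_expgs (a^-1 *: S); exists n.
(* [gen_expgs] gives a power of [1 |: X], and here [X] already contains 1. *)
have X1 : 1 |: (a^-1 *: S) = a^-1 *: S.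
  by apply/setUidPr; rewrite sub1set -(mulVg a) mem_lcoset mulKg.
rewrite -X1 -Xn gen_subG; apply/subsetP => _ /mulsgP[x y xS yS ->].
rewrite inE in xS.
have mX u : u \in S -> a^-1 * u \in <<a^-1 *: S>>.
  by move=> uS; rewrite mem_gen // mem_lcoset mulKg.
have := groupM (groupVr (mX _ xS)) (mX _ yS).
by rewrite !invMg !invgK -mulgA mulKVg.
Qed.

End DifferenceGroup.

Section TwistedGame.

Variables (gT : finGroupType) (sigma : gT -> gT) (S : {set gT}).
Hypothesis sigmaM : {morph sigma : x y / x * y}.
Hypothesis sigmaK : involutive sigma.
Hypothesis S_sym : S = S^-1.
Hypothesis undirected : symmetric (twisted_cayley_sum sigma S).

Local Notation e := (twisted_cayley_sum sigma S).
Local Notation H := (diffg S).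

Lemma twisted_cayley_sumE x y : e x y = (x * sigma y \in S).
Proof.
apply/exists_inP/idP => [[s sS /eqP ->]|xyS]; first by rewrite sigmaK mulKVg.
by exists (x * sigma y); rewrite // mulKg sigmaK.
Qed.

Let sigma1 : sigma 1 = 1.
Proof. by apply: (mulgI (sigma 1)); rewrite -sigmaM !mulg1. Qed.

Let sigmaV x : sigma x^-1 = (sigma x)^-1.
Proof. by apply: (mulgI (sigma x)); rewrite -sigmaM !mulgV sigma1. Qed.

Lemma mem_sigma x : (sigma x \in S) = (x \in S).
Proof.
by have := undirected 1 x; rewrite !twisted_cayley_sumE sigma1 mul1g mulg1.
Qed.

Lemma mem_mulC x y : (x * y \in S) = (y * x \in S).
Proof.
have := undirected x (sigma y); rewrite !twisted_cayley_sumE sigmaK => ->.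
by rewrite -sigmaM mem_sigma.
Qed.

Lemma mem_conj x y : (x ^ y \in S) = (x \in S).
Proof. by rewrite conjgE mem_mulC mulgK. Qed.

Lemma mem_inv x : (x^-1 \in S) = (x \in S).
Proof. by rewrite [in RHS]S_sym inE. Qed.

Definition twist (b : bool) x := if b then sigma x^-1 else x.

Lemma twistK b : involutive (twist b).
Proof. by case: b => x //=; rewrite sigmaV sigmaK invgK. Qed.

Lemma twist_edge b x y : e (twist b x) (twist (~~ b) y) = (x^-1 * y \in S).
Proof.
case: b => /=; rewrite twisted_cayley_sumE; first by rewrite -sigmaM mem_sigma.
by rewrite sigmaK -mem_inv invMg invgK mem_mulC.
Qed.

Lemma norm_diffg x y : (x ^ y \in H) = (x \in H).
Proof.
suff yH z : z \in 'N(H) by rewrite memJ_norm.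
apply: (subsetP (norm_gen _)); rewrite inE; apply/subsetP => w.
case/imsetP=> t /mulsgP[u v]; rewrite inE => uS vS -> {t}->.
by rewrite conjMg mem_mulg ?inE -?conjVg ?mem_conj.
Qed.

Lemma sigma_diffg x : x \in H -> sigma x \in H.
Proof.
case/gen_prodgP=> n [c cS ->]; rewrite (big_morph sigma sigmaM sigma1).
apply: group_prod => i _; have /mulsgP[u v] := cS i; rewrite inE => uS vS ->.
by rewrite sigmaM -[sigma u]invgK -sigmaV mem_diffg ?mem_sigma.
Qed.

(** [H] is normal and stable under [sigma], so each edge [x -> sigma x^-1 * sigma s] swaps [H] and
    [H a]. *)
Lemma connected_diffg a r :
  a \in S -> connect e 1 r -> (r \in H) || (r * a^-1 \in H).
Proof.
move=> aS /connectP[p ep ->]; have : (1 \in H) || (1 * a^-1 \in H).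
  by rewrite group1.
elim: p (1 : gT) ep => //= y p IHp x /andP[/exists_inP[s sS /eqP ->] {}ep xH].
apply: IHp ep _; have {}sS : sigma s \in S by rewrite mem_sigma.
rewrite sigmaM sigmaV; case/orP: xH => /sigma_diffg xH; apply/orP; [right|left].
  by rewrite -mulgA groupM ?groupV // -[sigma s]invgK mem_diffg // mem_inv.
have aS' : sigma a \in S by rewrite mem_sigma.
rewrite -(norm_diffg _ (sigma a)^-1).
have -> : ((sigma x)^-1 * sigma s) ^ (sigma a)^-1
    = (sigma (x * a^-1))^-1 * ((sigma s)^-1^-1 * (sigma a)^-1).
  by rewrite conjgE sigmaM sigmaV !invMg !invgK !mulgA.
by rewrite groupM ?groupV // mem_diffg // mem_inv.
Qed.

(* The robber has just moved from [r0] to [r], up to [twist], and the cop in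
   charge of [enum_val i] has to answer [m i] more moves along [enum_val i]. *)
Lemma cops_win_twist (m : 'I_#|S| -> nat) b (c : {ffun 'I_#|S| -> gT}) r0 r :
  r0^-1 * r \in S ->
  (forall i, (c i)^-1 * r0 \in ((enum_val i)^-1 *: S) ^+ m i) ->
  cops_win e [ffun i => twist (~~ b) (c i)] (twist b r).
Proof.
have [N] := ubnP (\sum_i m i); elim: N m b c r0 r => // N IHN m b c r0 r.
set s := r0^-1 * r => ltmN sS Dm; pose D i := (c i)^-1 * r0.
pose reply (u : 'I_#|S| -> gT) := [ffun i => r * (D i * (u i)^-1 * s)^-1].
have replyE u i : (reply u i)^-1 * r = D i * (u i)^-1 * s.
  by rewrite ffunE invMg invgK mulgKV.
have turn u : (forall i, u i \in S) ->
    cops_turn e [ffun i => twist (~~ b) (c i)] [ffun i => twist b (reply u i)].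
  move=> uS; apply/forallP=> i; rewrite !ffunE; apply/orP; right.
  have := twist_edge (~~ b) (c i) (r * (D i * (u i)^-1 * s)^-1).
  (* As [r * s^-1 = r0], the untwisted cop moves by [D i * u i * (D i)^-1], a conjugate of [u i]. *)
  rewrite negbK => ->; rewrite -(mem_conj _ (D i)) (_ : _ ^ _ = u i) //.
  by rewrite conjgE /D /s !invMg !invgK !mulgA !(mulgKV, mulgK) mulVg mul1g.
pose j := enum_rank_in sS s; have js : enum_val j = s by rewrite enum_rankK_in.
(* Here [D j = 1]: copying [s] puts cop [j] on the robber. *)
have [mj0|mj_gt0] := posnP (m j).
  apply: (WinCapturing (turn (fun=> s) (fun=> sS))).
  apply/existsP; exists j; rewrite ffunE; apply/eqP; congr twist.
  have := Dm j; rewrite mj0 expg0 => /set1P Dj1.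
  by rewrite ffunE /D Dj1 mul1g mulVg invg1 mulg1.
have := Dm j; rewrite -(prednK mj_gt0) expgSr => /mulsgP[d x dX].
rewrite mem_lcoset invgK js => sxS Dj.
(* With [D j = d * x], the reply [s * x] leaves the difference [d], one factor shorter; the other
   cops keep theirs. *)
pose u i := if i == j then s * x else s.
apply: (WinTurn (turn u _)) => [i||r' err']; first by rewrite /u; case: ifP.
  exists (twist (~~ b) (r * s)).
  by rewrite twist_edge mulKg.
rewrite -[r'](twistK (~~ b)) twist_edge in err'.
pose m' i := if i == j then (m j).-1 else m i.
have := IHN m' (~~ b) (reply u) r (twist (~~ b) r').
rewrite negbK twistK; apply=> // [|i].
  rewrite -ltnS (leq_trans _ ltmN) // ltnS.
  rewrite (bigD1 j) //= [leqRHS](bigD1 j) //= /m' eqxx.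
  rewrite -addSn (prednK mj_gt0) leq_add2l.
  by apply: leq_sum => i /negPf->.
rewrite replyE /u /m'; case: eqP => [->|_]; last by rewrite mulgKV; apply: Dm.
by rewrite js /D Dj invMg -[X in X * s]mulgA mulKVg mulgKV -js.
Qed.

Lemma cops_suffice_card :
  S != set0 -> connected_graph e -> cops_suffice e #|S|.
Proof.
case/set0Pn=> a aS conn.
pose c1 : {ffun 'I_#|S| -> gT} := [ffun=> 1]; exists c1=> r.
have twist1 b : twist b 1 = 1 by case: b => //=; rewrite invg1.
have win b r0 r' : r0 \in H -> r0^-1 * r' \in S ->
    cops_win e c1 (twist b r').
  move=> r0H r0r'.
  have [m Hm] := fin_all_exists (fun i => diffg_expgs (@enum_valP _ (mem S) i)).
  have -> : c1 = [ffun i => twist (~~ b) (c1 i)].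
    by apply/ffunP=> i; rewrite !ffunE twist1.
  apply: (@cops_win_twist m b c1 r0 r' r0r') => i.
  by rewrite ffunE invg1 mul1g (subsetP (Hm i)).
(* If [r] is in [H a], pretend that the robber has just come from [r * a^-1]. If [r] is in [H], wait
   one turn, so that its next move starts in [H]. *)
case/orP: (connected_diffg aS (conn 1 r)) => rH; last first.
  by apply: (win false _ r rH); rewrite invMg invgK mulgKV.
apply: (@WinTurn _ _ _ _ _ c1).
- by apply/forallP=> i; rewrite eqxx.
- by exists (twist true (r * a)); rewrite (twist_edge false) mulKg.
move=> r'; rewrite -[r'](twistK true) (twist_edge false); exact: win.
Qed.

End TwistedGame.

Theorem theorem1p3 (gT : finGroupType) (sigma : {perm gT}) (S : {set gT})
  (sigma_aut : sigma \in Aut [set: gT])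
  (sigma_order2 : #[sigma]%g = 2)
  (S_symmetric : S = (S^-1)%g)
  (undirected : symmetric (twisted_cayley_sum sigma S))
  (conn : connected_graph (twisted_cayley_sum sigma S)) :
  cop_number (twisted_cayley_sum sigma S) <= 2 * #|S|.
Proof.
have sigmaM : {morph sigma : x y / x * y}.
  by move=> x y; apply: (morphicP (Aut_morphic sigma_aut)); rewrite inE.
have sigmaK : involutive sigma.
  by move=> x; rewrite -permM -expg2 -sigma_order2 expg_order perm1.
(* Without edges, connectedness would force [sigma x = x] for all [x], against order two. *)
have S_neq0 : S != set0.
  apply: contra_eq_neq sigma_order2 => S0.
  suff -> : sigma = 1 by rewrite order1.
  apply/permP=> x; rewrite perm1.
  have /connectP[[//|y p]] := conn x (sigma x).
  by rewrite /= /twisted_cayley_sum S0 => /andP[/exists_inP[s]]; rewrite inE.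
apply: leq_trans (leq_pmull _ _) => //; apply: cop_number_le.
exact: cops_suffice_card.
Qed.
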